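(* Let $n\ge 1$ and let $L_1,\dots,L_n\in\mathbb{R}\setminus\{0\}$. On $\mathbb{R}^{2n+1}$ with coordinates $(x_1,\dots,x_{2n},t)$ let $T=\frac{\partial}{\partial t}$ and $$X_j=\frac{\partial}{\partial x_j}-L_j x_{j+n}\frac{\partial}{\partial t}\ (1\le j\le n),\qquad X_j=\frac{\partial}{\partial x_j}+L_{j-n}x_{j-n}\frac{\partial}{\partial t}\ (n+1\le j\le 2n).$$ Let $g$ be the $(2n+1)$-dimensional real Lie algebra spanned by $X_1,\dots,X_{2n},T$, and let $G$ be the associated step-two Carnot group on $\mathbb{R}^{2n+1}$. Endow $g$ with the inner product $\langle\cdot,\cdot\rangle$ for which the vectors $X_1,\dots,X_{2n},T$ are mutually orthogonal and $$\langle X_j,X_j\rangle=2|L_j|\ (1\le j\le n),\qquad \langle X_j,X_j\rangle=2|L_{j-n}|\ (n+1\le j\le 2n),\qquad \langle T,T\rangle=1.$$ Then $g$ with this inner product is a Heisenberg-type Lie algebra, and thus $G$ is a group of Heisenberg-type.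
   Context: The Lie algebra $g$ is stratified as $g=V_1\oplus V_2$ with $V_1=\operatorname{span}\{X_1,\dots,X_{2n}\}$ and $V_2=\operatorname{span}\{T\}$; for $j<k$ one has $[X_j,X_k]=2L_jT$ if $k=n+j$ and $[X_j,X_k]=0$ otherwise, and $T$ commutes with everything. The group $G$ is $\mathbb{R}^{2n+1}$ in exponential coordinates, $\exp(\sum_j x_jX_j+tT)=(x_1,\dots,x_{2n},t)$, with the group law given by the Baker-Campbell-Hausdorff formula. The center of a Lie algebra $g$ is $Z=\{z\in g:[v,z]=0\ \text{for all } v\in g\}$. A finite-dimensional real Lie algebra $g$ with an inner product $\langle\cdot,\cdot\rangle$ is a Heisenberg-type Lie algebra (with respect to that inner product) if $[Z^\perp,Z^\perp]=Z$ and, for every $z\in Z$ with $\langle z,z\rangle=1$, the linear map $J_z:Z^\perp\to Z^\perp$ defined by $\langle J_z(v),w\rangle=\langle z,[v,w]\rangle$ for all $w\in Z^\perp$ is orthogonal. A group of Heisenberg-type is a Carnot group whose Lie algebra is a Heisenberg-type Lie algebra. *)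

(* Defs.v *)
(* MathComp / MathComp-Analysis, over an arbitrary R : realType. *)
From HB Require Import structures.
From mathcomp Require Import all_boot all_order all_algebra.
From mathcomp Require Import all_classical all_reals all_analysis.

Set Implicit Arguments.
Unset Strict Implicit.
Unset Printing Implicit Defensive.

Import Order.TTheory GRing.Theory Num.Theory.
Import numFieldNormedType.Exports.

Local Open Scope classical_set_scope.
Local Open Scope ring_scope.

(** * Lie algebras

   A Lie algebra is a linear subspace g of an ambient R-vector space V with
   a bracket br defined on all of V but only constrained on g; g = setT is the
   abstract case.  Brackets of vector fields fit this form. *)

Section LieAlgebra.
Context {R : realType} {V : lmodType R}.
Implicit Types (br : V -> V -> V) (ip : V -> V -> R) (g A B : set V).

Definition subspace A : Prop :=
  A 0 /\ forall (a : R) u v, A u -> A v -> A (a *: u + v).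

Definition lspan A : set V := smallest subspace A.

Definition finite_dim A : Prop :=
  exists (m : nat) (b : 'I_m -> V), A = lspan (range b).

Definition lie_algebra br g : Prop :=
  [/\ subspace g,
      forall u v, g u -> g v -> g (br u v),
      forall (a : R) u v w, g u -> g v -> g w ->
        br (a *: u + v) w = a *: br u w + br v w /\
        br w (a *: u + v) = a *: br w u + br w v,
      forall u, g u -> br u u = 0 &
      forall u v w, g u -> g v -> g w ->
        br u (br v w) + br v (br w u) + br w (br u v) = 0].

(* [A, B] is the span of the brackets, not just the set of brackets. *)
Definition lie_prod br A B : set V :=
  lspan [set z | exists a b, [/\ A a, B b & z = br a b]].

Definition inner_product g ip : Prop :=
  [/\ forall u v, g u -> g v -> ip u v = ip v u,
      forall (a : R) u v w, g u -> g v -> g w ->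
        ip (a *: u + v) w = a * ip u w + ip v w &
      forall u, g u -> u != 0 -> 0 < ip u u].

Definition center br g : set V :=
  [set z | g z /\ forall v, g v -> br v z = 0].

Definition orth_compl g ip A : set V :=
  [set v | g v /\ forall w, A w -> ip v w = 0].

(* J is the map J_z : W -> W with <J_z v, w> = <z, [v, w]>, where W is meant
   to be the orthogonal complement of the center.  The values of J outside W
   are irrelevant. *)
Definition is_Jmap br ip (W : set V) (z : V) (J : V -> V) : Prop :=
  [/\ forall v, W v -> W (J v),
      forall (a : R) u v, W u -> W v -> J (a *: u + v) = a *: J u + J v &
      forall v w, W v -> W w -> ip (J v) w = ip z (br v w)].

Definition orthogonal_map ip (W : set V) (J : V -> V) : Prop :=
  forall v w, W v -> W w -> ip (J v) (J w) = ip v w.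

Definition heisenberg_type br g ip : Prop :=
  [/\ lie_algebra br g, finite_dim g, inner_product g ip &
      let Z := center br g in
      let W := orth_compl g ip Z in
      lie_prod br W W = Z /\
      forall z, Z z -> ip z z = 1 ->
        exists2 J, is_Jmap br ip W z J & orthogonal_map ip W J].

(* g is the direct sum of the layers W 1, ..., W s. *)
Definition direct_sum g (s : nat) (W : nat -> set V) : Prop :=
  (forall v, g v <->
     exists2 w : 'I_s -> V, (forall i : 'I_s, W i.+1 (w i)) & v = \sum_i w i) /\
  (forall w : 'I_s -> V, (forall i : 'I_s, W i.+1 (w i)) ->
     \sum_i w i = 0 -> forall i, w i = 0).

(* Step-s stratification: [V_1, V_i] = V_{i+1} for i < s, V_s <> 0 and
   [V_1, V_s] = 0. *)
Definition stratification br g (s : nat) (W : nat -> set V) : Prop :=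
  [/\ (0 < s)%N,
      forall i, (0 < i <= s)%N -> subspace (W i),
      direct_sum g s W,
      forall i, (0 < i < s)%N -> lie_prod br (W 1%N) (W i) = W i.+1 &
      W s <> [set 0] /\ lie_prod br (W 1%N) (W s) = [set 0]].

End LieAlgebra.

(** * Smooth maps, vector fields, and Lie groups on R^N *)

Section Smooth.
Context {R : realType} {U V : normedModType R}.

Fixpoint class_C (k : nat) (f : U -> V) : Prop :=
  if k is k'.+1
  then (forall x, differentiable f x) /\ forall v, class_C k' (fun x => 'D_v f x)
  else continuous f.

Definition smooth (f : U -> V) : Prop := forall k, class_C k f.

End Smooth.

Section LieGroup.
Context {R : realType} {N : nat}.
Local Notation E := 'rV[R]_N.

(* A vector field \sum_i a_i d/dx_i on R^N is encoded by its component map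
   p |-> (a_i(p))_i, so that the i-th component of [X, Y] is
   X(Y_i) - Y(X_i). *)
Definition vf_bracket (X Y : E -> E) : E -> E :=
  fun p => 'D_(X p) Y p - 'D_(Y p) X p.

Definition lie_group (mul : E -> E -> E) : Prop :=
  [/\ associative mul,
      smooth (fun pq : E * E => mul pq.1 pq.2) &
      exists (e : E) (inv : E -> E),
        [/\ left_id e mul, right_id e mul,
            left_inverse e inv mul, right_inverse e inv mul & smooth inv]].

(* Left-invariant fields: X(pq) = d(L_p)_q X(q).  No regularity of X has to be
   imposed: X is determined by its value at the identity, hence smooth when
   mul is. *)
Definition lie_algebra_of (mul : E -> E -> E) : set (E -> E) :=
  [set X | forall p q, X (mul p q) = 'D_(X q) (mul p) q].

(* A Carnot group is a connected, simply connected Lie group with stratified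
   Lie algebra; the underlying manifold is here R^N, so the two topological
   conditions hold by construction. *)
Definition carnot_group (s : nat) (mul : E -> E -> E) : Prop :=
  lie_group mul /\
  exists W, stratification vf_bracket (lie_algebra_of mul) s W.

Definition heisenberg_type_group (mul : E -> E -> E)
    (ip : (E -> E) -> (E -> E) -> R) : Prop :=
  (exists s, carnot_group s mul) /\
  heisenberg_type vf_bracket (lie_algebra_of mul) ip.

End LieGroup.

(** * The vector fields X_1, ..., X_{2n}, T on R^{2n+1} *)

Section Fields.
Context {R : realType} {n : nat}.
Variable L : 'I_n -> R.
Local Notation E := 'rV[R]_(n + n + 1).

(* Positions of x_k (k < 2n) and of t among the coordinates of R^{2n+1}. *)
Definition i_x (k : 'I_(n + n)) : 'I_(n + n + 1) := lshift 1 k.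
Definition i_t : 'I_(n + n + 1) := rshift (n + n) ord0.

Definition ddx (i : 'I_(n + n + 1)) : E := delta_mx ord0 i.

Definition fieldT : E -> E := fun=> ddx i_t.

Definition fieldX (k : 'I_(n + n)) : E -> E := fun p =>
  match fintype.split k with
  | inl j => ddx (i_x k) - (L j * p ord0 (i_x (rshift n j))) *: ddx i_t
  | inr j => ddx (i_x k) + (L j * p ord0 (i_x (lshift n j))) *: ddx i_t
  end.

Definition algebra_g : set (E -> E) := lspan (range fieldX `|` [set fieldT]).

(* The element \sum_k x_k X_k + t T of g with coordinates p = (x, t). *)
Definition of_coords (p : E) : E -> E :=
  \sum_(k < n + n) p ord0 (i_x k) *: fieldX k + p ord0 i_t *: fieldT.

(* The Baker-Campbell-Hausdorff product, which stops at the first bracket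
   because g has step two. *)
Definition bch (v w : E -> E) : E -> E := v + w + 2^-1 *: vf_bracket v w.

(* Group law in exponential coordinates.  At the origin X_k and T are the
   coordinate vectors, so of_coords p 0 = p: evaluating an element of g at 0
   reads off its coordinates in the basis X_1, ..., X_{2n}, T. *)
Definition group_law (p q : E) : E := bch (of_coords p) (of_coords q) 0.

End Fields.

(* Main.v *)
From Pilot Require Import Defs.
From HB Require Import structures.
From mathcomp Require Import all_boot all_order all_algebra.
From mathcomp Require Import all_classical all_reals all_analysis.
From mathcomp Require Import ring.

Set Implicit Arguments.
Unset Strict Implicit.
Unset Printing Implicit Defensive.

Import Order.TTheory GRing.Theory Num.Theory.
Import numFieldNormedType.Exports.
(* [subspace] is meant linearly, not as the topological construction. *)
Import Pilot.Defs.

Local Open Scope classical_set_scope.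
Local Open Scope ring_scope.

(** For p in R^(2n+1), write F_p for the element of g with coordinates p. The
    elements of g are exactly the affine fields F_p(q) = p + omega(q, p) d/dt,
    where omega is the bilinear form
    omega(p, q) = sum_j L_j (p_j q_(j+n) - p_(j+n) q_j)
    ([of_coordsE], [algebra_gE]). The form omega is alternating, ignores the
    t coordinate and, all L_j being nonzero, has no further degeneracy.
    Everything is read off from it.

    Differentiating gives [F_p, F_q] = 2 omega(p, q) T ([vf_bracketE]), so
    that the Jacobi identity holds term by term, the center is the line of T
    ([center_g]), and g is stratified by the span of the X_k and the line of T
    ([stratification_g]). The group law is p q = p + q + omega(p, q) e_t
    ([group_lawE]); a left-invariant field is determined by its value at 0,
    and translating that value a gives precisely F_a, so the Lie algebra of G
    is g ([lie_algebra_of_group_law]). The law is polynomial of degree two,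
    hence smooth ([smooth_group_law]).

    For the Heisenberg-type condition, the orthogonal complement of the center
    is the first layer, where the squared norms 2|L_j| of X_j and X_(j+n)
    agree. For z = c T, the identity <J_z v, w> = 2 c omega(v, w) forces J_z
    to act on each plane spanned by X_j and X_(j+n) as the rotation by a right
    angle times c sg(L_j): the factor |L_j| coming from the norms is absorbed
    by L_j = sg(L_j) |L_j| ([ip_rotation]). When c^2 = 1 this is orthogonal
    ([rotation_isometry]). *)

(** * Subspaces and spans *)

Section Subspaces.
Context {R : realType}.

Lemma subspace_lspan (V : lmodType R) (A : set V) : subspace (lspan A).
Proof.
split=> [B [[B0 _] _] //|a u v Au Av B BP].
by case: (BP) => -[_ +] _; apply; [apply: Au|apply: Av].
Qed.

Lemma subspace_sum (V : lmodType R) (A : set V) m (c : 'I_m -> R)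
    (b : 'I_m -> V) :
  subspace A -> (forall i, A (b i)) -> A (\sum_i c i *: b i).
Proof.
move=> [A0 AP] Ab; elim/big_ind: _ => // [u v Au Av|i _].
  by rewrite -[u]scale1r; apply: AP.
by rewrite -[_ *: _]addr0; apply: AP.
Qed.

Lemma subspace_image (U V : lmodType R) (f : {linear U -> V}) (A : set U) :
  subspace A -> subspace (f @` A).
Proof.
move=> [A0 AP]; split; first by exists 0; rewrite ?linear0.
move=> a _ _ [u Au <-] [v Av <-].
by exists (a *: u + v); rewrite ?linearP//; apply: AP.
Qed.

Lemma subspace_setT (V : lmodType R) : subspace [set: V].
Proof. by []. Qed.

Lemma lspan_image_delta m (V : lmodType R) (f : {linear 'rV[R]_m -> V}) :
  lspan (range (fun i => f (delta_mx ord0 i))) = range f.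
Proof.
apply/seteqP; split.
  apply: smallest_sub; first exact: subspace_image (subspace_setT _).
  by move=> _ [i _ <-]; exists (delta_mx ord0 i).
move=> _ [p _ <-]; rewrite [p]row_sum_delta linear_sum /=.
under eq_bigr do rewrite linearZ /=.
apply: (@subspace_sum V (lspan _)); first exact: subspace_lspan.
by move=> i; apply: sub_gen_smallest; exists i.
Qed.

Lemma bilinear_diagonal m (phi : 'rV[R]_m -> 'rV[R]_m -> R) :
  (forall a u v w, phi (a *: u + v) w = a * phi u w + phi v w) ->
  (forall u v, phi u v = phi v u) ->
  (forall i j, i != j -> phi (delta_mx ord0 i) (delta_mx ord0 j) = 0) ->
  forall p q, phi p q =
    \sum_i p ord0 i * q ord0 i * phi (delta_mx ord0 i) (delta_mx ord0 i).
Proof.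
move=> phiP phiC phi0.
have phi0l w : phi 0 w = 0.
  have := phiP 1 0 0 w; rewrite scaler0 addr0 mul1r => /eqP.
  by rewrite addrC -subr_eq subrr => /eqP.
have phiE p w : phi p w = \sum_i p ord0 i * phi (delta_mx ord0 i) w.
  rewrite {1}[p]row_sum_delta.
  elim/big_rec2: _ => [|i x y _ <-]; first exact: phi0l.
  exact: phiP.
move=> p q; rewrite phiE; apply: eq_bigr => i _.
rewrite phiC phiE (bigD1 i)//= big1 ?addr0; first by rewrite mulrA.
by move=> j ji; rewrite phi0 ?mulr0.
Qed.

End Subspaces.

(** * Derivatives of polynomial maps of degree at most two *)

Section Derivatives.
Context {R : realType}.

(** Along a line, a polynomial map of degree two is its own Taylor expansion,
    so a directional derivative is found by algebra alone; the bracket, the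
    left-invariance condition and smoothness are all computed this way. *)
Lemma derive_quadratic (U V : normedModType R) (f : U -> V) (x v : U)
    (a b : V) :
  (forall h : R, f (h *: v + x) = f x + h *: a + h ^+ 2 *: b) ->
  'D_v f x = a.
Proof.
move=> fE; rewrite /derive; apply: cvg_lim => //.
have E : {near 0^', (fun h : R => a + h *: b) =1
    (fun h => h^-1 *: ((f \o shift x) (h *: v) - f x))}.
  near=> h; have h0 : h != 0 by near: h; exact: nbhs_dnbhs_neq.
  rewrite /= fE addrAC [f x + _ - _]addrAC subrr add0r.
  by rewrite expr2 -scalerA -scalerDr scalerA mulVf ?scale1r.
apply: (cvg_trans (near_eq_cvg E)).
have h0 : (fun h : R => h) @ 0^' --> (0 : R) by exact: cvg_within.
have := cvgD (cvg_cst a (F := 0^')) (cvgZ h0 (cvg_cst b (F := 0^'))).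
by rewrite scale0r addr0; apply.
Unshelve. all: by end_near. Qed.

Lemma smooth_cst (U V : normedModType R) (c : V) : smooth (cst c : U -> V).
Proof.
move=> k; elim: k c => [|k IH] c /=; first exact: cst_continuous.
split=> // v; rewrite [X in class_C _ X](_ : _ = cst 0)//.
by apply/funext => x; exact: derive_cst.
Qed.

(** One differentiation lowers the degree, so this reduces quadratic maps to
    affine ones and affine maps to constants. *)
Lemma smooth_of_derive (U V : normedModType R) (f : U -> V) :
  (forall x, differentiable f x) -> (forall v, smooth (fun x => 'D_v f x)) ->
  smooth f.
Proof.
move=> df sf [|k]; first by move=> x; exact/differentiable_continuous.
by split=> // v; apply: sf.
Qed.

Lemma smooth_affine (U V : normedModType R) (l : U -> V) (c : V) :
  linear l -> continuous l -> smooth (fun x => l x + c).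
Proof.
move=> ll lc; pose l' : {linear U -> V} :=
  HB.pack l (GRing.isLinear.Build R U V *:%R l ll).
apply: smooth_of_derive => [x|v].
  by apply: differentiableD => //; exact: (linear_differentiable (f := l')).
rewrite [X in smooth X](_ : _ = cst (l v)); first exact: smooth_cst.
apply/funext => x; apply: (derive_quadratic (b := 0)) => h.
by rewrite ll scaler0 addr0 -addrA addrC.
Qed.

End Derivatives.

(** * Coordinates and the symplectic form *)

Section Coordinates.
Context {R : realType} {n : nat}.
Local Notation E := 'rV[R]_(n + n + 1).
Implicit Types p q : E.

Definition xlo (j : 'I_n) p : R := p ord0 (i_x (lshift n j)).
Definition xhi (j : 'I_n) p : R := p ord0 (i_x (rshift n j)).
Definition tcoord p : R := p ord0 i_t.
Definition et : E := ddx i_t.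

(** The vector (x, y, t) of R^(2n+1), where x and y are the halves (x_1, ...,
    x_n) and (x_(n+1), ..., x_2n) read by [xlo] and [xhi]. *)
Definition point (x y : 'I_n -> R) (t : R) : E :=
  row_mx (row_mx (\row_j x j) (\row_j y j)) (\row_j t).

Lemma xlo_point x y t j : xlo j (point x y t) = x j.
Proof. by rewrite /xlo /point row_mxEl row_mxEl mxE. Qed.

Lemma xhi_point x y t j : xhi j (point x y t) = y j.
Proof. by rewrite /xhi /point row_mxEl row_mxEr mxE. Qed.

Lemma tcoord_point x y t : tcoord (point x y t) = t.
Proof. by rewrite /tcoord /point row_mxEr mxE. Qed.

Definition pointE := (xlo_point, xhi_point, tcoord_point).

Lemma coord_eq p q : (forall j, xlo j p = xlo j q) ->
  (forall j, xhi j p = xhi j q) -> tcoord p = tcoord q -> p = q.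
Proof.
move=> lo hi t; apply/rowP => i.
case: (split_ordP i) => [k ->|k ->]; last by rewrite [k]ord1; exact: t.
by case: (split_ordP k) => j ->; [exact: lo|exact: hi].
Qed.

Lemma xlo_is_linear j : linear_for *%R (xlo j).
Proof. by move=> a p q; rewrite /xlo !mxE. Qed.

HB.instance Definition _ j :=
  GRing.isLinear.Build R E R *%R (xlo j) (xlo_is_linear j).

Lemma xhi_is_linear j : linear_for *%R (xhi j).
Proof. by move=> a p q; rewrite /xhi !mxE. Qed.

HB.instance Definition _ j :=
  GRing.isLinear.Build R E R *%R (xhi j) (xhi_is_linear j).

Lemma tcoord_is_linear : linear_for *%R tcoord.
Proof. by move=> a p q; rewrite /tcoord !mxE. Qed.

HB.instance Definition _ :=
  GRing.isLinear.Build R E R *%R tcoord tcoord_is_linear.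

Lemma xlo_et j : xlo j et = 0.
Proof. by rewrite /xlo /et /ddx mxE /= eq_lrshift. Qed.

Lemma xhi_et j : xhi j et = 0.
Proof. by rewrite /xhi /et /ddx mxE /= eq_lrshift. Qed.

Lemma tcoord_et : tcoord et = 1.
Proof. by rewrite /tcoord /et /ddx mxE !eqxx. Qed.

Lemma xlo_delta k j : xlo j (ddx (i_x k)) = (k == lshift n j)%:R.
Proof. by rewrite /xlo /ddx mxE eq_lshift eq_sym. Qed.

Lemma xhi_delta k j : xhi j (ddx (i_x k)) = (k == rshift n j)%:R.
Proof. by rewrite /xhi /ddx mxE eq_lshift eq_sym. Qed.

Lemma tcoord_delta k : tcoord (ddx (i_x k)) = 0.
Proof. by rewrite /tcoord /ddx mxE eq_rlshift. Qed.

End Coordinates.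

Section Form.
Context {R : realType} {n : nat}.
Context (L : 'I_n -> R).
Local Notation E := 'rV[R]_(n + n + 1).
Implicit Types p q r : E.

Definition omega p q : R :=
  \sum_j L j * (xlo j p * xhi j q - xhi j p * xlo j q).

Lemma omegaC p q : omega q p = - omega p q.
Proof. by rewrite -sumrN; apply: eq_bigr => j _; ring. Qed.

Lemma omega_is_linear p : linear_for *%R (omega p).
Proof.
move=> a q r; rewrite mulr_sumr -big_split /=; apply: eq_bigr => j _.
by rewrite !linearP /=; ring.
Qed.

HB.instance Definition _ p :=
  GRing.isLinear.Build R E R *%R (omega p) (omega_is_linear p).

Lemma omegaPl a p q r : omega (a *: p + q) r = a * omega p r + omega q r.
Proof. by rewrite omegaC linearP /= !(omegaC r); ring. Qed.

Lemma omegaDl p q r : omega (p + q) r = omega p r + omega q r.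
Proof. by rewrite -[p]scale1r omegaPl mul1r scale1r. Qed.

Lemma omegapp p : omega p p = 0.
Proof. by rewrite /omega big1// => j _; ring. Qed.

Lemma omega_et p : omega p et = 0.
Proof. by rewrite /omega big1// => j _; rewrite xlo_et xhi_et; ring. Qed.

Lemma omega_vertical p c : omega p (c *: et) = 0.
Proof. by rewrite linearZ /= omega_et mulr0. Qed.

Lemma omega_vertical_l p c : omega (c *: et) p = 0.
Proof. by rewrite omegaC omega_vertical oppr0. Qed.

Lemma omega_delta_lo p j : omega p (ddx (i_x (lshift n j))) = - (L j * xhi j p).
Proof.
rewrite /omega (bigD1 j)//= big1 => [|k kj].
  by rewrite xlo_delta xhi_delta eqxx eq_lrshift /=; ring.
by rewrite xlo_delta xhi_delta eq_lshift eq_lrshift eq_sym (negbTE kj) /=; ring.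
Qed.

Lemma omega_delta_hi p j : omega p (ddx (i_x (rshift n j))) = L j * xlo j p.
Proof.
rewrite /omega (bigD1 j)//= big1 => [|k kj].
  by rewrite xlo_delta xhi_delta eqxx eq_rlshift /=; ring.
by rewrite xlo_delta xhi_delta eq_rshift eq_rlshift eq_sym (negbTE kj) /=; ring.
Qed.

Local Notation F := (of_coords L).

Lemma fieldXE k x :
  fieldX L k x = ddx (i_x k) + omega x (ddx (i_x k)) *: et.
Proof.
rewrite /fieldX; case: split_ordP => j ->; last by rewrite omega_delta_hi.
by rewrite omega_delta_lo scaleNr.
Qed.

Lemma sum_ddx p : p = \sum_k p ord0 (i_x k) *: ddx (i_x k) + tcoord p *: et.
Proof. by rewrite [LHS]row_sum_delta big_split_ord big_ord1. Qed.

Lemma of_coordsE p x : F p x = p + omega x p *: et.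
Proof.
rewrite /of_coords addrfctE fct_sumE /fieldT.
under eq_bigr do rewrite scalrfctE fieldXE scalerDr scalerA.
rewrite big_split /= -scaler_suml addrAC -sum_ddx; congr (_ + _ *: _).
rewrite [p in RHS]sum_ddx linearD linear_sum linearZ /= omega_et mulr0 addr0.
by apply: eq_bigr => k _; rewrite linearZ.
Qed.

Lemma of_coords_is_linear : linear F.
Proof.
move=> a p q; apply/funext => x.
rewrite addrfctE scalrfctE !of_coordsE linearP /=.
by rewrite scalerDr scalerA scalerDl addrACA.
Qed.

HB.instance Definition _ :=
  GRing.isLinear.Build R E (E -> E) *:%R F of_coords_is_linear.

Lemma of_coords_zero : F 0 = 0.
Proof. exact: (linear0 F). Qed.

Lemma of_coordsP a p q : a *: F p + F q = F (a *: p + q).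
Proof. by rewrite of_coords_is_linear. Qed.

Lemma of_coordsD p q : F p + F q = F (p + q).
Proof. by rewrite -[F p]scale1r of_coordsP scale1r. Qed.

Lemma of_coords0 p : F p 0 = p.
Proof. by rewrite of_coordsE omegaC linear0 oppr0 scale0r addr0. Qed.

Lemma of_coords_delta k : F (ddx (i_x k)) = fieldX L k.
Proof. by apply/funext => x; rewrite of_coordsE fieldXE. Qed.

Lemma of_coords_et : F et = fieldT.
Proof. by apply/funext => x; rewrite of_coordsE omega_et scale0r addr0. Qed.

Lemma algebra_g_delta :
  algebra_g L = lspan (range (fun i => F (delta_mx ord0 i))).
Proof.
congr lspan; apply/seteqP; split.
  move=> _ [[k _ <-]|->]; first by exists (i_x k) => //; exact: of_coords_delta.
  by exists i_t => //; exact: of_coords_et.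
move=> _ [i _ <-]; case: (split_ordP i) => [k ->|k ->].
  by left; exists k => //; rewrite -of_coords_delta.
by right; rewrite [k]ord1 -of_coords_et.
Qed.

(** Every element of g is a combination of the generators with constant
    coefficients, which are its coordinates; this lets all statements about g
    be checked on vectors of R^(2n+1). *)
Lemma algebra_gE : algebra_g L = range F.
Proof. by rewrite algebra_g_delta lspan_image_delta. Qed.

Lemma derive_of_coords p x v : 'D_v (F p) x = omega v p *: et.
Proof.
apply: (derive_quadratic (b := 0)) => h.
by rewrite scaler0 addr0 !of_coordsE omegaPl scalerDl scalerA addrA addrAC.
Qed.

(** Since F_q is affine with linear part x |-> omega(x, q) d/dt and omega
    ignores t, D_(F_p(x)) F_q = omega(p, q) d/dt at every x; antisymmetry
    doubles it. *)
Lemma vf_bracketE p q : vf_bracket (F p) (F q) = F ((2 * omega p q) *: et).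
Proof.
apply/funext => x; rewrite /vf_bracket !derive_of_coords.
have E r s : omega (F r x) s = omega r s.
  by rewrite of_coordsE addrC omegaPl (omegaC s) omega_et; ring.
rewrite !E (omegaC p q) -scalerBl of_coordsE omega_vertical scale0r.
by rewrite addr0; congr (_ *: _); ring.
Qed.

Lemma group_lawE p q : group_law L p q = p + q + omega p q *: et.
Proof.
rewrite /group_law /bch vf_bracketE !addrfctE scalrfctE !of_coords0 scalerA.
by rewrite mulrA mulVf ?mul1r// pnatr_eq0.
Qed.

End Form.

(** * The stratified Lie algebra *)

Section Algebra.
Context {R : realType} {n : nat}.
Context (L : 'I_n -> R).
Local Notation E := 'rV[R]_(n + n + 1).
Local Notation F := (of_coords L).
Local Notation br := (@vf_bracket R (n + n + 1)).
Implicit Types p q : E.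

Lemma of_coords_inj : injective F.
Proof. by move=> p q pq; rewrite -[p](of_coords0 L) pq of_coords0. Qed.

Lemma vf_bracket_eq0 p q : br (F p) (F q) = 0 -> omega L p q = 0.
Proof.
rewrite vf_bracketE -(of_coords_zero L) => /of_coords_inj/(congr1 tcoord).
rewrite linearZ linear0 /= tcoord_et mulr1 => /eqP.
by rewrite mulf_eq0 pnatr_eq0 /= => /eqP.
Qed.

Lemma lie_algebra_g : lie_algebra br (algebra_g L).
Proof.
split.
- exact: subspace_lspan.
- rewrite algebra_gE => _ _ [p _ <-] [q _ <-].
  by exists ((2 * omega L p q) *: et); rewrite ?vf_bracketE.
- rewrite algebra_gE => a _ _ _ [p _ <-] [q _ <-] [r _ <-].
  rewrite of_coordsP !vf_bracketE omegaPl omega_is_linear.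
  by split; rewrite of_coordsP scalerA -scalerDl; congr (F (_ *: _)); ring.
- rewrite algebra_gE => _ [p _ <-].
  by rewrite vf_bracketE omegapp mulr0 scale0r of_coords_zero.
- rewrite algebra_gE => _ _ _ [p _ <-] [q _ <-] [r _ <-].
  by rewrite !vf_bracketE !omega_vertical !mulr0 scale0r of_coords_zero !addr0.
Qed.

Lemma finite_dim_g : finite_dim (algebra_g L).
Proof.
by exists (n + n + 1), (fun i => F (delta_mx ord0 i)); exact: algebra_g_delta.
Qed.

Definition horizontal : set (E -> E) := F @` [set p | tcoord p = 0].
Definition vertical : set (E -> E) := F @` range (fun c : R => c *: et).

Lemma subspace_horizontal : subspace horizontal.
Proof.
apply: subspace_image; split=> [|a u v /= u0 v0]; first exact: linear0.
by rewrite linearP /= u0 v0 mulr0 addr0.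
Qed.

Lemma subspace_vertical : subspace vertical.
Proof.
apply: subspace_image; split=> [|a _ _ [c _ <-] [d _ <-]].
  by exists 0; rewrite ?scale0r.
by exists (a * c + d); rewrite // scalerDl scalerA.
Qed.

Lemma horizontal_sub : horizontal `<=` algebra_g L.
Proof. by rewrite algebra_gE => _ [p _ <-]; exists p. Qed.

Lemma vertical_sub : vertical `<=` algebra_g L.
Proof. by rewrite algebra_gE => _ [p _ <-]; exists p. Qed.

Lemma vf_bracket_vertical p q : vertical (br (F p) (F q)).
Proof.
by rewrite vf_bracketE; exists ((2 * omega L p q) *: et) => //; eexists.
Qed.

(** Bracketing F_p with X_j and X_(j+n) isolates the coordinates x_(j+n) and
    x_j of p, up to the nonzero factor L_j. *)
Lemma center_g : (forall j, L j != 0) -> center br (algebra_g L) = vertical.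
Proof.
move=> L0; rewrite algebra_gE; apply/seteqP; split.
  move=> _ [[p _ <-] pC].
  have pk k : omega L p (ddx (i_x k)) = 0.
    rewrite omegaC; apply/eqP; rewrite oppr_eq0; apply/eqP.
    by apply: vf_bracket_eq0; apply: pC; eexists.
  exists (tcoord p *: et); first by exists (tcoord p).
  congr F; apply: coord_eq => [j|j|]; rewrite linearZ /=.
  - have /eqP := pk (rshift n j).
    rewrite omega_delta_hi mulf_eq0 (negbTE (L0 j)) /= => /eqP ->.
    by rewrite xlo_et mulr0.
  - have /eqP := pk (lshift n j).
    rewrite omega_delta_lo oppr_eq0 mulf_eq0 (negbTE (L0 j)) /= => /eqP ->.
    by rewrite xhi_et mulr0.
  - by rewrite tcoord_et mulr1.
move=> _ [_ [c _ <-] <-]; split; first by exists (c *: et).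
move=> _ [p _ <-].
by rewrite vf_bracketE omega_vertical mulr0 scale0r of_coords_zero.
Qed.

(** One pair (X_1, X_(1+n)) already produces every multiple of T, by scaling
    X_1. *)
Lemma lie_prod_horizontal : (0 < n)%N -> (forall j, L j != 0) ->
  lie_prod br horizontal horizontal = vertical.
Proof.
move=> n0 L0; apply/seteqP; split.
  apply: smallest_sub; first exact: subspace_vertical.
  by move=> _ [_ [_ [[p _ <-] [q _ <-] ->]]]; exact: vf_bracket_vertical.
move=> _ [_ [c _ <-] <-]; apply: sub_gen_smallest.
pose j := Ordinal n0.
(* [X_1, X_(1+n)] = 2 L_1 T. *)
exists (F ((c / (2 * L j)) *: ddx (i_x (lshift n j)))).
exists (F (ddx (i_x (rshift n j)))); split.
- exists ((c / (2 * L j)) *: ddx (i_x (lshift n j))) => //=.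
  by rewrite linearZ /= tcoord_delta mulr0.
- by exists (ddx (i_x (rshift n j))); rewrite //= tcoord_delta.
rewrite vf_bracketE; congr (F (_ *: _)).
rewrite omega_delta_hi linearZ /= xlo_delta eqxx mulr1.
by have := L0 j => Lj; field.
Qed.

Lemma lie_prod_vertical : lie_prod br horizontal vertical = [set 0].
Proof.
apply/seteqP; split.
  apply: smallest_sub; first by split=> // a u v -> ->; rewrite scaler0 addr0.
  move=> _ [_ [_ [[p _ <-] [_ [c _ <-] <-] ->]]].
  by rewrite vf_bracketE omega_vertical mulr0 scale0r of_coords_zero.
by move=> _ ->; exact: (subspace_lspan _).1.
Qed.

Definition layer (i : nat) : set (E -> E) :=
  if i == 1%N then horizontal else vertical.

Lemma direct_sum_layer : direct_sum (algebra_g L) 2 layer.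
Proof.
split=> [v|w Ww].
  split.
    rewrite algebra_gE => -[p _ <-].
    exists (fun i : 'I_2 => if i == ord0 then F (p - tcoord p *: et)
                            else F (tcoord p *: et)).
      move=> [[|[|//]] i2]; rewrite /layer /=.
        exists (p - tcoord p *: et) => //=.
        by rewrite linearB linearZ /= tcoord_et mulr1 subrr.
      by exists (tcoord p *: et) => //; exists (tcoord p).
    by rewrite big_ord_recl big_ord1 /= of_coordsD subrK.
  move=> [w Ww ->]; rewrite big_ord_recl big_ord1.
  rewrite -[w ord0]scale1r; apply: (subspace_lspan _).2.
    by apply: horizontal_sub; exact: (Ww ord0).
  by apply: vertical_sub; exact: (Ww (lift ord0 ord0)).
rewrite big_ord_recl big_ord1.
have [p p0 pw] := Ww ord0; have [_ [c _ <-] cw] := Ww (lift ord0 ord0).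
rewrite -pw -cw of_coordsD -(of_coords_zero L) => /of_coords_inj pc.
have c0 : c = 0.
  move/(congr1 tcoord): (pc).
  by rewrite linearD linearZ linear0 /= p0 tcoord_et mulr1 add0r.
move: pc cw; rewrite c0 scale0r addr0 => p00 cw i.
case: (unliftP ord0 i) => [k|] ->; first by rewrite [k]ord1 -cw.
by rewrite -pw p00 of_coords_zero.
Qed.

Lemma stratification_g : (0 < n)%N -> (forall j, L j != 0) ->
  stratification br (algebra_g L) 2 layer.
Proof.
move=> n0 L0; split => //.
- move=> i _; rewrite /layer; case: ifP => _; first exact: subspace_horizontal.
  exact: subspace_vertical.
- exact: direct_sum_layer.
- by move=> [|[|//]] // _; rewrite /layer /= lie_prod_horizontal.
- split; last exact: lie_prod_vertical.
  rewrite /layer /= => V0.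
  have : [set 0] (F et).
    by rewrite -V0; exists et => //; exists 1; rewrite ?scale1r.
  rewrite /= -(of_coords_zero L) => /of_coords_inj/(congr1 tcoord)/eqP.
  by rewrite tcoord_et linear0 oner_eq0.
Qed.

End Algebra.

(** * The Carnot group *)

Section Group.
Context {R : realType} {n : nat}.
Context (L : 'I_n -> R).
Local Notation E := 'rV[R]_(n + n + 1).
Local Notation F := (of_coords L).
Local Notation br := (@vf_bracket R (n + n + 1)).
Implicit Types p q : E.

Lemma derive_group_law p q v :
  'D_v (group_law L p) q = v + omega L p v *: et.
Proof.
apply: (derive_quadratic (b := 0)) => h.
by rewrite !group_lawE linearP /=; apply/rowP => i; rewrite !mxE; ring.
Qed.

(** Left invariance at the pair (p, 0) expresses X(p) through X(0); conversely
    F_a is left-invariant because omega is bilinear and ignores t. *)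
Lemma lie_algebra_of_group_law : lie_algebra_of (group_law L) = algebra_g L.
Proof.
rewrite algebra_gE; apply/seteqP; split=> [X XL|_ [a _ <-] p q].
  exists (X 0) => //; apply/funext => p.
  have := XL p 0; rewrite derive_group_law group_lawE linear0 scale0r !addr0.
  by rewrite of_coordsE => ->.
rewrite derive_group_law group_lawE !of_coordsE.
rewrite !omegaDl linearD /= omega_vertical omega_vertical_l.
by apply/rowP => i; rewrite !mxE; ring.
Qed.

(** Both sides are p + q + r + (omega(p, q) + omega(p, r) + omega(q, r)) e_t. *)
Lemma group_lawA : associative (group_law L).
Proof.
move=> p q r; rewrite !group_lawE.
rewrite !omegaDl !linearD /= omega_vertical omega_vertical_l.
by apply/rowP => i; rewrite !mxE; ring.
Qed.

Lemma differentiable_omega (U : normedModType R) (f g : U -> E) x :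
  differentiable f x -> differentiable g x ->
  differentiable (fun y => omega L (f y) (g y)) x.
Proof.
move=> df dg.
have dc (h : U -> E) i : differentiable h x ->
    differentiable (fun y => h y ord0 i) x.
  move=> dh.
  exact: (differentiable_comp dh (differentiable_coord (h x) ord0 i)).
have -> : (fun y => omega L (f y) (g y)) = \sum_j L j *:
    ((xlo j \o f) * (xhi j \o g) - (xhi j \o f) * (xlo j \o g)).
  by apply/funext => y; rewrite fct_sumE.
apply: differentiable_sum => j; apply: differentiableZ.
by apply: differentiableB; apply: differentiableM; exact: dc.
Qed.

Lemma differentiable_fst (U V : normedModType R) (x : U * V) :
  differentiable (fst : U * V -> U) x.
Proof. by apply: linear_differentiable => y; exact: cvg_fst. Qed.

Lemma differentiable_snd (U V : normedModType R) (x : U * V) :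
  differentiable (snd : U * V -> V) x.
Proof. by apply: linear_differentiable => y; exact: cvg_snd. Qed.

Lemma smooth_group_law :
  smooth (fun pq : E * E => group_law L pq.1 pq.2).
Proof.
have -> : (fun pq : E * E => group_law L pq.1 pq.2) =
    fst + snd + (fun pq => omega L pq.1 pq.2 *: et).
  by apply/funext => pq; rewrite group_lawE.
have d1 := @differentiable_fst E E; have d2 := @differentiable_snd E E.
apply: smooth_of_derive => [x|v].
  apply: differentiableD; first exact: differentiableD.
  by apply: differentiableZl; exact: differentiable_omega.
(* The linear part of the derivative of the law in the direction v. *)
pose l (x : E * E) : E := (omega L v.1 x.2 + omega L x.1 v.2) *: et.
rewrite [X in smooth X](_ : _ = fun x => l x + (v.1 + v.2)).
  apply: smooth_affine => [a x y|x].
    rewrite /l /= linearP omegaPl /=.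
    by apply/rowP => i; rewrite !mxE; ring.
  apply/differentiable_continuous/differentiableZl.
  by apply: differentiableD; exact: differentiable_omega.
apply/funext => x; apply: (derive_quadratic (b := omega L v.1 v.2 *: et)) => h.
rewrite !addrfctE /l /= !omegaPl !linearP /=.
move: et (omega L v.1 v.2) (omega L v.1 x.2).
move: (omega L x.1 v.2) (omega L x.1 x.2).
by move=> a b e c d; apply/rowP => i; rewrite !mxE; ring.
Qed.

Lemma lie_group_group_law : lie_group (group_law L).
Proof.
split; [exact: group_lawA|exact: smooth_group_law|].
exists 0, -%R; split=> [p|p|p|p|].
- by rewrite group_lawE omegaC linear0 oppr0 scale0r addr0 add0r.
- by rewrite group_lawE linear0 scale0r !addr0.
- rewrite group_lawE omegaC linearN /= omegapp.
  by rewrite !oppr0 scale0r addr0 addNr.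
- by rewrite group_lawE linearN /= omegapp oppr0 scale0r addr0 subrr.
- rewrite (_ : -%R = fun p : E => - p + 0).
    apply: smooth_affine => [a p q|]; first by rewrite opprD scalerN.
    exact: opp_continuous.
  by apply/funext => p; rewrite addr0.
Qed.

Lemma carnot_group_group_law : (0 < n)%N -> (forall j, L j != 0) ->
  carnot_group 2 (group_law L).
Proof.
move=> n0 L0; split; first exact: lie_group_group_law.
rewrite lie_algebra_of_group_law; exists (layer L); exact: stratification_g.
Qed.

End Group.

(** * The Heisenberg-type condition *)

Section HeisenbergType.
Context {R : realType} {n : nat}.
Context (L : 'I_n -> R).
Local Notation E := 'rV[R]_(n + n + 1).
Local Notation F := (of_coords L).
Local Notation br := (@vf_bracket R (n + n + 1)).
Context (ip : (E -> E) -> (E -> E) -> R).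
Context (ip_inner : inner_product (algebra_g L) ip)
  (ip_XX : forall k l, k != l -> ip (fieldX L k) (fieldX L l) = 0)
  (ip_XT : forall k, ip (fieldX L k) fieldT = 0)
  (ip_X_lo : forall j : 'I_n,
     ip (fieldX L (lshift n j)) (fieldX L (lshift n j)) = 2 * `|L j|)
  (ip_X_hi : forall j : 'I_n,
     ip (fieldX L (rshift n j)) (fieldX L (rshift n j)) = 2 * `|L j|)
  (ip_T : ip fieldT fieldT = 1).
Implicit Types p q : E.

Lemma ip_of_coords p q : ip (F p) (F q) =
  \sum_j 2 * `|L j| * (xlo j p * xlo j q + xhi j p * xhi j q)
  + tcoord p * tcoord q.
Proof.
have [ipC ipP _] := ip_inner.
have gF r : algebra_g L (F r) by rewrite algebra_gE; exists r.
have FX k : F (delta_mx ord0 (lshift 1 k)) = fieldX L k := of_coords_delta L k.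
have Ft : F (delta_mx ord0 (rshift (n + n) ord0)) = fieldT := of_coords_et L.
rewrite (@bilinear_diagonal R _ (fun p q => ip (F p) (F q))).
- rewrite big_split_ord big_ord1 /= Ft ip_T mulr1; congr (_ + _).
  rewrite big_split_ord /= -big_split /=; apply: eq_bigr => j _.
  by rewrite !FX ip_X_lo ip_X_hi /xlo /xhi; ring.
- by move=> a u v w; rewrite -of_coordsP; apply: ipP; exact: gF.
- by move=> u v; exact: ipC.
move=> i j.
case: (split_ordP i) => k ->; case: (split_ordP j) => l ->.
- rewrite eq_lshift => kl.
  by rewrite !FX ip_XX.
- by rewrite [l]ord1 => _; rewrite FX Ft ip_XT.
- rewrite [k]ord1 => _; rewrite ipC//.
  by rewrite FX Ft ip_XT.
- by rewrite [k]ord1 [l]ord1 eqxx.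
Qed.

Lemma ip_of_coords_vertical p c : ip (F p) (F (c *: et)) = c * tcoord p.
Proof.
rewrite ip_of_coords big1 ?add0r => [|j _].
  by rewrite linearZ /= tcoord_et; ring.
by rewrite !linearZ /= xlo_et xhi_et; ring.
Qed.

Lemma orth_compl_vertical :
  orth_compl (algebra_g L) ip (vertical L) = horizontal L.
Proof.
rewrite algebra_gE; apply/seteqP; split.
  move=> _ [[p _ <-] pV]; exists p => //=.
  have := pV (F (1 *: et)); rewrite ip_of_coords_vertical mul1r; apply.
  by exists (1 *: et) => //; exists 1.
move=> _ [p /= p0 <-]; split; first by exists p.
by move=> _ [_ [c _ <-] <-]; rewrite ip_of_coords_vertical p0 mulr0.
Qed.

(** The coordinates of J_(cT) F_p, found by solving <J F_p, F_q> = 2 c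
    omega(p, q) for all horizontal q: each plane of X_j, X_(j+n) is rotated by
    a right angle and multiplied by c sg(L_j). *)
Definition rotation (c : R) p : E :=
  point (fun j => - (c * Num.sg (L j) * xhi j p))
        (fun j => c * Num.sg (L j) * xlo j p) 0.

Lemma rotation_is_linear c : linear (rotation c).
Proof.
by move=> a p q; apply: coord_eq => [j|j|];
  rewrite linearP /= !pointE ?linearP /=; ring.
Qed.

(** The weight 2|L_j| of the inner product and the sign in the rotation
    combine to the coefficient 2 L_j of the bracket. *)
Lemma ip_rotation c p q :
  ip (F (rotation c p)) (F q) = c * (2 * omega L p q).
Proof.
rewrite ip_of_coords !pointE mul0r addr0 /omega !mulr_sumr.
by apply: eq_bigr => j _; rewrite !pointE -[L j in RHS]mulr_sg_norm; ring.
Qed.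

(** X_j and X_(j+n) have the same norm, so a right-angle rotation of their
    plane is an isometry, and (c sg(L_j))^2 = 1. *)
Lemma rotation_isometry c p q : (forall j, L j != 0) -> c ^+ 2 = 1 ->
  tcoord p = 0 -> ip (F (rotation c p)) (F (rotation c q)) = ip (F p) (F q).
Proof.
move=> L0 c1 p0; rewrite !ip_of_coords !pointE p0 !mul0r; congr (_ + _).
apply: eq_bigr => j _; rewrite !pointE.
have sg1 : Num.sg (L j) ^+ 2 = 1 by rewrite sqr_sg L0.
transitivity (2 * `|L j| * (c ^+ 2 * Num.sg (L j) ^+ 2 *
  (xlo j p * xlo j q + xhi j p * xhi j q))); first by ring.
by rewrite c1 sg1 !mul1r.
Qed.

Lemma heisenberg_type_g : (0 < n)%N -> (forall j, L j != 0) ->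
  heisenberg_type br (algebra_g L) ip.
Proof.
move=> n0 L0; split=> //; [exact: lie_algebra_g|exact: finite_dim_g|].
rewrite /= center_g// orth_compl_vertical.
split; first exact: lie_prod_horizontal.
move=> _ [_ [c _ <-] <-].
rewrite ip_of_coords_vertical linearZ /= tcoord_et mulr1.
(* The value of a field of g at 0 is its coordinate vector. *)
move=> c1; exists (fun X => F (rotation c (X 0))); first split.
- move=> _ [p _ <-]; exists (rotation c (F p 0)) => //=; exact: tcoord_point.
- by move=> a u v _ _; rewrite addrfctE scalrfctE rotation_is_linear of_coordsP.
- move=> _ _ [p p0 <-] [q q0 <-].
  rewrite of_coords0 ip_rotation vf_bracketE ip_of_coords_vertical.
  by rewrite linearZ /= tcoord_et; ring.
- move=> _ _ [p p0 <-] [q q0 <-]; rewrite !of_coords0.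
  by rewrite rotation_isometry ?expr2.
Qed.

End HeisenbergType.

Theorem mainTheorem1 (R : realType) (n : nat) (L : 'I_n -> R)
    (ip : ('rV[R]_(n + n + 1) -> 'rV[R]_(n + n + 1)) ->
          ('rV[R]_(n + n + 1) -> 'rV[R]_(n + n + 1)) -> R)
    (n_ge1 : (1 <= n)%N)
    (L_neq0 : forall j, L j != 0)
    (ip_inner : inner_product (algebra_g L) ip)
    (ip_XX : forall k l, k != l -> ip (fieldX L k) (fieldX L l) = 0)
    (ip_XT : forall k, ip (fieldX L k) fieldT = 0)
    (ip_X_lo : forall j : 'I_n,
       ip (fieldX L (lshift n j)) (fieldX L (lshift n j)) = 2 * `|L j|)
    (ip_X_hi : forall j : 'I_n,
       ip (fieldX L (rshift n j)) (fieldX L (rshift n j)) = 2 * `|L j|)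
    (ip_T : ip fieldT fieldT = 1) :
  (* G is the step-two Carnot group associated with g *)
  (lie_algebra_of (group_law L) = algebra_g L /\
   carnot_group 2 (group_law L)) /\
  heisenberg_type vf_bracket (algebra_g L) ip /\
  heisenberg_type_group (group_law L) ip.
Proof.
have GE := lie_algebra_of_group_law L.
have G2 : carnot_group 2 (group_law L) by exact: carnot_group_group_law.
have gH : heisenberg_type vf_bracket (algebra_g L) ip.
  exact: heisenberg_type_g ip_inner ip_XX ip_XT ip_X_lo ip_X_hi ip_T _ _.
split; first by split; [exact: GE|exact: G2].
split; first exact: gH.
by split; [exists 2; exact: G2|rewrite GE; exact: gH].
Qed.
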